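(* Let $\sigma\in\mathcal{D}$, $\varepsilon\in(0,1]$, and let $\varphi:\mathcal{D}\to\mathbb{R}$ be Schur concave. Then $$\rho^*_\varepsilon(\sigma)\in\operatorname*{argmax}_{B_\varepsilon(\sigma)}\varphi\qquad\text{and}\qquad\rho_{*,\varepsilon}(\sigma)\in\operatorname*{argmin}_{B_\varepsilon(\sigma)}\varphi .$$ If $\varphi$ is strictly Schur concave, then any other state $\rho'\in\operatorname{argmax}_{B_\varepsilon(\sigma)}\varphi$ (resp. $\rho'\in\operatorname{argmin}_{B_\varepsilon(\sigma)}\varphi$) is unitarily equivalent to $\rho^*_\varepsilon(\sigma)$ (resp. $\rho_{*,\varepsilon}(\sigma)$). If $\varphi$ is strictly concave, then $\operatorname{argmax}_{B_\varepsilon(\sigma)}\varphi=\{\rho^*_\varepsilon(\sigma)\}$.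
   Context: $\mathcal{H}$ is a complex Hilbert space of finite dimension $d\ge 2$; $\mathcal{D}$ is the set of states (density matrices: positive semidefinite operators on $\mathcal{H}$ of trace one); $\tau=\frac1d\mathbf{1}$; $\|A\|_1=\mathrm{Tr}|A|$; $B_\varepsilon(\sigma)=\{\omega\in\mathcal{D}:\frac12\|\omega-\sigma\|_1\le\varepsilon\}$. Majorization: for $x,y\in\mathbb{R}^d$ with non-increasing rearrangements $x^\downarrow,y^\downarrow$, $y\prec x$ means $\sum_{j=1}^k y^\downarrow_j\le\sum_{j=1}^k x^\downarrow_j$ for $k=1,\dots,d-1$ and $\sum_{j=1}^d y_j=\sum_{j=1}^d x_j$. For states, $\rho\prec\omega$ means that the vector of eigenvalues (with multiplicity) of $\rho$ is majorized by that of $\omega$. A function $\varphi:\mathcal{D}\to\mathbb{R}$ is Schur concave if $\varphi(\rho)\ge\varphi(\omega)$ whenever $\rho\prec\omega$; it is strictly Schur concave if moreover $\varphi(\rho)>\varphi(\omega)$ whenever $\rho\prec\omega$ and $\rho$ is not unitarily equivalent to $\omega$. Let $\sigma=\sum_{i=1}^d\mu_i|i\rangle\langle i|$ be an eigendecomposition with $\mu_1\ge\dots\ge\mu_d$ and $(|i\rangle)$ an orthonormal basis. Definition of $\rho^*_\varepsilon(\sigma)$: if $\frac12\|\sigma-\tau\|_1\le\varepsilon$, set $\rho^*_\varepsilon(\sigma)=\tau$. If $\frac12\|\sigma-\tau\|_1>\varepsilon$, there are a unique pair $(\alpha_1,n)\in[0,1]\times\{1,\dots,d-1\}$ with $\sum_{i=d-n+1}^d|\alpha_1-\mu_i|=\varepsilon$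 and $\mu_{d-n+1}<\alpha_1\le\mu_{d-n}$, and a unique pair $(\alpha_2,m)\in[0,1]\times\{1,\dots,d-1\}$ with $\sum_{i=1}^m|\alpha_2-\mu_i|=\varepsilon$ and $\mu_{m+1}\le\alpha_2<\mu_m$; moreover $\alpha_1<\frac1d<\alpha_2$ (so $m\le d-n$). Then $$\rho^*_\varepsilon(\sigma)=\sum_{i=1}^m\alpha_2|i\rangle\langle i|+\sum_{i=m+1}^{d-n}\mu_i|i\rangle\langle i|+\sum_{i=d-n+1}^d\alpha_1|i\rangle\langle i|.$$ Definition of $\rho_{*,\varepsilon}(\sigma)$: write $q_i=\mu_i$ and set $\rho_{*,\varepsilon}(\sigma)=\sum_{i=1}^d p_{i*}|i\rangle\langle i|$, where: if $q_d>\varepsilon$, $(p_{i*})=(q_1+\varepsilon,q_2,\dots,q_{d-1},q_d-\varepsilon)$. Otherwise let $\ell\in\{1,\dots,d-1\}$ be the largest index with $Q_\ell:=\sum_{j=d-\ell+1}^d q_j\le\varepsilon$. If $\ell=d-1$, $(p_{i*})=(1,0,\dots,0)$. If $\ell<d-1$, $p_{1*}=q_1+\varepsilon$, $p_{j*}=q_j$ for $2\le j\le d-\ell-1$, $p_{(d-\ell)*}=q_{d-\ell}-(\varepsilon-Q_\ell)$, and $p_{j*}=0$ for $j\ge d-\ell+1$. *)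

(* Defs.v *)
From mathcomp Require Import all_boot all_order all_algebra.
From mathcomp Require Import complex.
From mathcomp Require Import classical_sets reals.

Set Implicit Arguments.
Unset Strict Implicit.
Unset Printing Implicit Defensive.

Import Order.TTheory GRing.Theory Num.Theory.

Local Open Scope classical_set_scope.
Local Open Scope complex_scope.
Local Open Scope sesquilinear_scope.
Local Open Scope ring_scope.

(* The d-dimensional complex Hilbert space is C^d with C = R[i], its operators
   being 'M[R[i]]_d and its vectors (kets) the columns 'cV[R[i]]_d. The indices
   1, ..., d of the eigenvalues become 0, ..., d - 1: mu_i is mu`_(i - 1). *)

Section Majorization.
Variables (R : realType) (d : nat).

Definition majorized (y x : d.-tuple R) : Prop :=
  (forall k : nat, (1 <= k <= d.-1)%N ->
     \sum_(j < k) (sort >=%R y)`_j <= \sum_(j < k) (sort >=%R x)`_j) /\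
  \sum_(j < d) y`_j = \sum_(j < d) x`_j.

End Majorization.

Section States.
Variables (R : realType) (d : nat).
Local Notation op := 'M[R[i]]_d.

Definition psdmx (A : op) : Prop :=
  A \is hermsymmx /\ forall v : 'cV[R[i]]_d, 0 <= (v^t* *m A *m v) ord0 ord0.

Definition density : set op := [set rho | psdmx rho /\ \tr rho = 1].

Definition max_mixed : op := (d%:R^-1)%:M.

(* |A| is the positive square root of A^* A, taken by functional calculus. *)
Definition absmx (A : op) : op :=
  let B := A^t* *m A in
  invmx (spectralmx B) *m diag_mx (map_mx sqrtC (spectral_diag B))
    *m spectralmx B.

Definition trace_norm (A : op) : R := complex.Re (\tr (absmx A)).

Definition state_ball (eps : R) (sigma : op) : set op :=
  [set omega | density omega /\ 2^-1 * trace_norm (omega - sigma) <= eps].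

(* Meaningful for Hermitian operators, whose spectral_diag is real. *)
Definition eigenvalues (rho : op) : d.-tuple R :=
  [tuple complex.Re (spectral_diag rho ord0 i) | i < d].

Definition state_majorized (rho omega : op) : Prop :=
  majorized (eigenvalues rho) (eigenvalues omega).

Definition unitarily_equivalent (rho omega : op) : Prop :=
  exists2 U : op, U \is unitarymx & rho = U *m omega *m U^t*.

(* A functional phi : density -> R is represented by a function on all
   operators, of which only the values on density are ever used. *)

Definition Schur_concave (phi : op -> R) : Prop :=
  forall rho omega : op, density rho -> density omega ->
    state_majorized rho omega -> phi omega <= phi rho.

Definition strictly_Schur_concave (phi : op -> R) : Prop :=
  Schur_concave phi /\
  forall rho omega : op, density rho -> density omega ->
    state_majorized rho omega -> ~ unitarily_equivalent rho omega ->
    phi omega < phi rho.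

Definition strictly_concave (phi : op -> R) : Prop :=
  forall (rho omega : op) (t : R), density rho -> density omega ->
    rho != omega -> 0 < t < 1 ->
    t * phi rho + (1 - t) * phi omega
      < phi (t%:C *: rho + (1 - t)%:C *: omega).

Definition argmax (A : set op) (phi : op -> R) : set op :=
  [set x | A x /\ forall y, A y -> phi y <= phi x].

Definition argmin (A : set op) (phi : op -> R) : set op :=
  [set x | A x /\ forall y, A y -> phi x <= phi y].

(* d orthonormal vectors of C^d automatically form a basis. *)
Definition orthonormal_basis (e : 'I_d -> 'cV[R[i]]_d) : Prop :=
  forall i j : 'I_d, (e i)^t* *m e j = ((i == j)%:R)%:M.

Definition diagonal_op (e : 'I_d -> 'cV[R[i]]_d) (p : d.-tuple R) : op :=
  \sum_(i < d) (p`_i)%:C *: (e i *m (e i)^t*).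

Definition eigendecomposition (sigma : op) (mu : d.-tuple R)
    (e : 'I_d -> 'cV[R[i]]_d) : Prop :=
  [/\ orthonormal_basis e, sorted >=%R mu & sigma = diagonal_op e mu].

End States.

Section Extremizers.
Variables (R : realType) (d : nat) (mu : d.-tuple R) (eps : R).

Definition lower_cut (an : R * nat) : Prop :=
  let: (a, n) := an in
  [/\ 0 <= a <= 1, (1 <= n <= d.-1)%N,
      \sum_(d - n <= i < d) `|a - mu`_i| = eps
    & mu`_(d - n) < a <= mu`_(d - n).-1].

Definition upper_cut (am : R * nat) : Prop :=
  let: (a, m) := am in
  [/\ 0 <= a <= 1, (1 <= m <= d.-1)%N,
      \sum_(0 <= i < m) `|a - mu`_i| = eps
    & mu`_m <= a < mu`_m.-1].

(* The pairs (alpha_1, n) and (alpha_2, m); the default value is taken only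
   when no pair satisfies the condition. *)
Definition lower_level : R * nat := xget (0, 0%N) [set an | lower_cut an].
Definition upper_level : R * nat := xget (0, 0%N) [set am | upper_cut am].

Definition flattened_spectrum : d.-tuple R :=
  [tuple if (i < upper_level.2)%N then upper_level.1
         else if (i < d - lower_level.2)%N then mu`_i
         else lower_level.1 | i < d].

Definition tail_sum (l : nat) : R := \sum_(d - l <= j < d) mu`_j.

Definition cut_length : nat :=
  \max_(l < d | (0 < l)%N && (tail_sum l <= eps)) l.

Definition steepened_spectrum : d.-tuple R :=
  if eps < mu`_d.-1 then
    [tuple if i == 0%N :> nat then mu`_i + eps
           else if i == d.-1 :> nat then mu`_i - eps
           else mu`_i | i < d]
  else if cut_length == d.-1 then
    [tuple if i == 0%N :> nat then 1 else 0 | i < d]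
  else
    [tuple if i == 0%N :> nat then mu`_i + eps
           else if (i < d - cut_length - 1)%N then mu`_i
           else if i == (d - cut_length - 1)%N :> nat then
             mu`_i - (eps - tail_sum cut_length)
           else 0 | i < d].

Variables (sigma : 'M[R[i]]_d) (e : 'I_d -> 'cV[R[i]]_d).

Definition rho_upper : 'M[R[i]]_d :=
  if 2^-1 * trace_norm (sigma - max_mixed R d) <= eps then max_mixed R d
  else diagonal_op e flattened_spectrum.

Definition rho_lower : 'M[R[i]]_d := diagonal_op e steepened_spectrum.

End Extremizers.

(* Main.v *)
(* For a spectrum s put excess s t = \sum_i max (s_i - t) 0. If two spectra have
   the same sum, then s is majorized by s' as soon as excess s <= excess s'
   pointwise, and the sum of the k largest entries of s is at most
   k t + excess s t, with equality when t is the k-th largest entry. The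
   diagonal of a Hermitian A in any orthonormal basis is a doubly stochastic
   average of its eigenvalues; taking the eigenbasis of one of two states, this
   gives |excess omega t - excess sigma t| <= eps for omega in the ball around
   sigma.

   The flattened spectrum is max a1 (min mu_i a2). Its excess vanishes for
   t >= a2, equals excess mu t - eps for a1 <= t <= a2 and 1 - d t for t <= a1,
   in each case a lower bound for the excess of every omega in the ball. The
   k-th partial sum of the steepened spectrum is
   min 1 (mu_1 + ... + mu_k + eps), which bounds the sum of the k largest
   eigenvalues of every such omega. For strictly concave phi, uniqueness follows
   from the midpoint of two maximizers, the ball being convex. *)
Require Import Defs.
From mathcomp Require Import all_boot all_order all_algebra.
From mathcomp Require Import complex.
From mathcomp Require Import classical_sets reals.
From mathcomp Require boolp.
From mathcomp Require Import ring lra zify.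

Set Implicit Arguments.
Unset Strict Implicit.
Unset Printing Implicit Defensive.

Import Order.TTheory GRing.Theory Num.Theory.

Local Open Scope classical_set_scope.
Local Open Scope complex_scope.
Local Open Scope ring_scope.

(** * Spectra of unitarily diagonalized operators *)

Section Spectral.
Local Open Scope sesquilinear_scope.

Lemma char_poly_similar (F : fieldType) n (V A : 'M[F]_n) :
  V \in unitmx -> char_poly (invmx V *m A *m V) = char_poly A.
Proof.
move=> Vu; rewrite /char_poly /char_poly_mx.
have VV : map_mx polyC (invmx V) *m map_mx polyC V = 1%:M.
  by rewrite -map_mxM mulVmx // map_mx1.
have -> : 'X%:M - map_mx polyC (invmx V *m A *m V) =
    map_mx polyC (invmx V) *m ('X%:M - map_mx polyC A) *m map_mx polyC V.
  rewrite mulmxBr mulmxBl -!map_mxM; congr (_ - _).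
  by rewrite mul_mx_scalar -scalemxAl VV scale_scalar_mx mulr1.
by rewrite !det_mulmx mulrAC -det_mulmx VV det1 mul1r.
Qed.

Lemma char_poly_diag_mx (F : fieldType) n (s : 'rV[F]_n) :
  char_poly (diag_mx s) = \prod_(x <- [seq s 0 i | i : 'I_n]) ('X - x%:P).
Proof.
rewrite char_poly_trig ?diag_mx_is_trig // big_image /=.
by apply: eq_bigr => i _; rewrite mxE eqxx mulr1n.
Qed.

Section UnitaryConjugation.
Variables (C : numClosedFieldType) (n : nat).
Implicit Types (U V A : 'M[C]_n) (s : 'rV[C]_n).

Lemma conj_diag_adj V s : s \is a mxOver Num.real ->
  (V^t* *m diag_mx s *m V)^t* = V^t* *m diag_mx s *m V.
Proof.
move=> /mxOverP sr; rewrite !trmx_mul !map_mxM trmxCK tr_diag_mx map_diag_mx.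
rewrite mulmxA; congr (_ *m diag_mx _ *m _); apply/rowP => i.
by rewrite mxE; apply/CrealP.
Qed.

Lemma conj_diag_hermitian V s : s \is a mxOver Num.real ->
  V^t* *m diag_mx s *m V \is hermsymmx.
Proof.
by move=> sr; apply/is_hermitianmxP; rewrite expr0 scale1r conj_diag_adj.
Qed.

Lemma conj_diag_sqr V s : V \is unitarymx ->
  (V^t* *m diag_mx s *m V) *m (V^t* *m diag_mx s *m V) =
  V^t* *m diag_mx (\row_i (s 0 i ^+ 2)) *m V.
Proof.
move=> Vu; rewrite !mulmxA mulmxtVK // -(mulmxA _ (diag_mx _) (diag_mx _)).
by rewrite mulmx_diag; congr (_ *m diag_mx _ *m _).
Qed.

Lemma hermitian_spectral A : A \is hermsymmx ->
  A = (spectralmx A)^t* *m diag_mx (spectral_diag A) *m spectralmx A.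
Proof.
move=> /hermitian_normalmx/orthomx_spectralP {1}->.
by rewrite invmx_unitary ?spectral_unitarymx.
Qed.

(** Both diagonals list the roots of the characteristic polynomial of [A], which is invariant under
    similarity. Hence [spectral_diag] can be replaced, up to order, by any diagonalization at
    hand. *)
Lemma perm_spectral_diag V A s :
  V \is unitarymx -> A \is normalmx -> A = V^t* *m diag_mx s *m V ->
  perm_eq [seq spectral_diag A 0 i | i : 'I_n] [seq s 0 i | i : 'I_n].
Proof.
move=> Vu; have Vun := unitarymx_unit Vu; rewrite -invmx_unitary //.
move=> /orthomx_spectralP A1 A2; apply: prod_XsubC_eq.
rewrite -!char_poly_diag_mx -(char_poly_similar (diag_mx s) Vun) -A2.
by rewrite -(char_poly_similar _ (spectral_unit A)) -A1.
Qed.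

Lemma unitary_mul_adj U V : U \is unitarymx -> V \is unitarymx ->
  U *m V^t* \is unitarymx.
Proof. by move=> Uu Vu; rewrite mul_unitarymx // trmxC_unitary. Qed.

Lemma unitary_sum_row U i : U \is unitarymx -> \sum_j `|U i j| ^+ 2 = 1.
Proof.
move=> /unitarymxP /matrixP /(_ i i); rewrite !mxE eqxx mulr1n => <-.
by apply: eq_bigr => j _; rewrite normCK !mxE.
Qed.

Lemma unitary_sum_col U j : U \is unitarymx -> \sum_i `|U i j| ^+ 2 = 1.
Proof.
rewrite -trmx_unitary => /(unitary_sum_row j) <-.
by apply: eq_bigr => i _; rewrite mxE.
Qed.

Lemma conj_diag_entry U V s i :
  (U *m (V^t* *m diag_mx s *m V) *m U^t*) i i =
  \sum_j s 0 j * `|(U *m V^t*) i j| ^+ 2.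
Proof.
have -> : U *m (V^t* *m diag_mx s *m V) *m U^t* =
    (U *m V^t*) *m diag_mx s *m (U *m V^t*)^t*.
  by rewrite trmx_mul map_mxM trmxCK !mulmxA.
move: (U *m V^t*) => X; rewrite mxE; apply: eq_bigr => j _.
by rewrite mul_mx_diag !mxE mulrAC -normCK mulrC.
Qed.

Lemma trace_conj_diag V s : V \is unitarymx ->
  \tr (V^t* *m diag_mx s *m V) = \sum_i s 0 i.
Proof.
by move=> Vu; rewrite mxtrace_mulC mulmxA (unitarymxP Vu) mul1mx mxtrace_diag.
Qed.

Lemma conj_diag_eigenbasis V s i : V \is unitarymx ->
  (V *m (V^t* *m diag_mx s *m V) *m V^t*) i i = s 0 i.
Proof.
move=> /unitarymxP Vu; rewrite !mulmxA Vu mul1mx.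
by rewrite -mulmxA Vu mulmx1 !mxE eqxx mulr1n.
Qed.

Lemma trace_spectral_conj A s :
  \tr (invmx (spectralmx A) *m diag_mx s *m spectralmx A) = \sum_i s 0 i.
Proof.
have Pu := spectral_unitarymx A.
by rewrite invmx_unitary ?trace_conj_diag.
Qed.

Lemma trace_conj U A : U \is unitarymx -> \tr (U *m A *m U^t*) = \tr A.
Proof.
move=> Uu; rewrite mxtrace_mulC mulmxA.
by rewrite -invmx_unitary // mulVmx ?unitarymx_unit // mul1mx.
Qed.

End UnitaryConjugation.

(** * Operators with a real spectrum over [R[i]] *)

Variables (R : realType) (d : nat).
Local Notation op := 'M[R[i]]_d.
Implicit Types (U V A B : op) (p q : d.-tuple R).

Lemma ReD (x y : R[i]) : complex.Re (x + y) = complex.Re x + complex.Re y.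
Proof. by case: x; case: y. Qed.

Lemma Re_sum (I : Type) (r : seq I) (P : pred I) (F : I -> R[i]) :
  complex.Re (\sum_(i <- r | P i) F i) = \sum_(i <- r | P i) complex.Re (F i).
Proof. exact: (big_morph _ ReD). Qed.

Lemma ReZ (a : R) (z : R[i]) : complex.Re (a%:C * z) = a * complex.Re z.
Proof. by case: z => x y /=; rewrite mul0r subr0. Qed.

Lemma conjC_real (a : R) : Num.conj a%:C = a%:C.
Proof. by apply/CrealP; apply/complex_realP; exists a. Qed.

Definition complex_row p : 'rV[R[i]]_d := \row_i (p`_i)%:C.

Lemma complex_row_real p : complex_row p \is a mxOver Num.real.
Proof.
by apply/mxOverP => i j; rewrite mxE; apply/complex_realP; exists p`_j.
Qed.

(** For unitary [V], the columns of its adjoint are eigenvectors with the real eigenvalues [p], in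
    any order. Spectral decompositions and [diagonal_op] are both brought to this form. *)
Definition unitary_diag V p : op := V^t* *m diag_mx (complex_row p) *m V.

Lemma unitary_diag_adj V p : (unitary_diag V p)^t* = unitary_diag V p.
Proof. exact/conj_diag_adj/complex_row_real. Qed.

Lemma unitary_diag_hermitian V p : unitary_diag V p \is hermsymmx.
Proof. exact/conj_diag_hermitian/complex_row_real. Qed.

Lemma hermitian_unitary_diag A : A \is hermsymmx ->
  A = unitary_diag (spectralmx A) (eigenvalues A).
Proof.
move=> Ah; rewrite /unitary_diag (_ : complex_row _ = spectral_diag A).
  exact: hermitian_spectral.
apply/rowP => i; rewrite mxE nth_mktuple; apply: RRe_real.
by have /mxOverP := hermitian_spectral_diag_real Ah; apply.
Qed.

Lemma perm_eigenvalues V p : V \is unitarymx ->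
  perm_eq (eigenvalues (unitary_diag V p)) p.
Proof.
move=> Vu; have An := hermitian_normalmx (unitary_diag_hermitian V p).
have := perm_map (@complex.Re R) (perm_spectral_diag Vu An erefl).
have mapE (s : 'rV[R[i]]_d) : map (@complex.Re R) [seq s 0 i | i : 'I_d] =
    [tuple complex.Re (s 0 i) | i < d].
  by rewrite /image_mem -map_comp.
rewrite !mapE; congr (is_true (perm_eq _ _)).
apply: (congr1 val); apply: eq_from_tnth => i.
by rewrite tnth_mktuple mxE (tnth_nth 0).
Qed.

Lemma trace_unitary_diag V p : V \is unitarymx ->
  \tr (unitary_diag V p) = (\sum_(i < d) p`_i)%:C.
Proof.
move=> Vu; rewrite /unitary_diag trace_conj_diag // rmorph_sum.
by apply: eq_bigr => i _; rewrite mxE.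
Qed.

Lemma unitary_diag_sqr V p : V \is unitarymx ->
  unitary_diag V p *m unitary_diag V p =
  unitary_diag V [tuple p`_i ^+ 2 | i < d].
Proof.
move=> Vu; rewrite /unitary_diag.
have <- : \row_i (complex_row p 0 i ^+ 2) =
    complex_row [tuple p`_i ^+ 2 | i < d].
  by apply/rowP => i; rewrite !mxE nth_mktuple rmorphXn.
exact: conj_diag_sqr.
Qed.

Lemma sqrtC_real_sqr (a : R) : sqrtC (a ^+ 2)%:C = `|a|%:C.
Proof.
rewrite rmorphXn /= -[_ ^+ 2]real_normK; last by apply/complex_realP; exists a.
by rewrite sqrCK // normc_def /= expr0n addr0 sqrtr_sqr.
Qed.

(** [absmx] uses a diagonalization of the squared operator that may differ from [V]. Its diagonal is
    a permutation of the squares of [p], and the trace sees only the multiset of their square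
    roots. *)
Lemma trace_norm_unitary_diag V p : V \is unitarymx ->
  trace_norm (unitary_diag V p) = \sum_(i < d) `|p`_i|.
Proof.
move=> Vu; rewrite /trace_norm /absmx unitary_diag_adj unitary_diag_sqr //.
set q := [tuple p`_i ^+ 2 | i < d]; set B := unitary_diag V q.
have Bn := hermitian_normalmx (unitary_diag_hermitian V q).
have Bp := perm_spectral_diag Vu Bn erefl.
rewrite trace_spectral_conj.
transitivity
  (complex.Re (\sum_(x <- [seq spectral_diag B 0 i | i : 'I_d]) sqrtC x)).
  by rewrite big_image /=; under eq_bigr do rewrite mxE.
rewrite (perm_big _ Bp) big_image /= Re_sum; apply: eq_bigr => i _.
by rewrite mxE nth_mktuple sqrtC_real_sqr.
Qed.

(** For unitary [U], the diagonal of [A] in the basis of the columns of the adjoint of [U]; when [A]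
    is Hermitian these entries are real, so the real part loses nothing. *)
Definition diag_in U A (i : 'I_d) : R := complex.Re ((U *m A *m U^t*) i i).

Lemma diag_inD U A B i : diag_in U (A + B) i = diag_in U A i + diag_in U B i.
Proof. by rewrite /diag_in mulmxDr mulmxDl mxE ReD. Qed.

Lemma diag_inZ U (a : R) A i : diag_in U (a%:C *: A) i = a * diag_in U A i.
Proof. by rewrite /diag_in -scalemxAr -scalemxAl mxE ReZ. Qed.

Lemma diag_inB U A B i : diag_in U (A - B) i = diag_in U A i - diag_in U B i.
Proof.
by rewrite diag_inD -scaleN1r -(rmorphN1 (real_complex R)) diag_inZ mulN1r.
Qed.

Lemma sum_diag_in U A : U \is unitarymx ->
  \sum_i diag_in U A i = complex.Re (\tr A).
Proof. by move=> Uu; rewrite -Re_sum -(trace_conj A Uu). Qed.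

Lemma diag_in_eigenbasis V p i : V \is unitarymx ->
  diag_in V (unitary_diag V p) i = p`_i.
Proof. by move=> Vu; rewrite /diag_in conj_diag_eigenbasis // mxE. Qed.

(* The weights are the squared moduli of the entries of [U *m V^t*]. *)
Lemma diag_in_doubly_stochastic U V p : U \is unitarymx -> V \is unitarymx ->
  exists W : 'I_d -> 'I_d -> R,
    [/\ forall i j, 0 <= W i j, forall i, \sum_j W i j = 1,
        forall j, \sum_i W i j = 1
      & forall i, diag_in U (unitary_diag V p) i = \sum_j W i j * p`_j].
Proof.
move=> Uu Vu; have Xu := unitary_mul_adj Uu Vu.
have E i : diag_in U (unitary_diag V p) i =
    \sum_j complex.Re (`|(U *m V^t*) i j| ^+ 2) * p`_j.
  rewrite /diag_in conj_diag_entry Re_sum; apply: eq_bigr => j _.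
  by rewrite mxE ReZ mulrC.
move: (U *m V^t*) Xu E => X Xu E.
exists (fun i j => complex.Re (`|X i j| ^+ 2)); split=> //.
- move=> i j; have : 0 <= `|X i j| ^+ 2 by exact: exprn_ge0.
  by rewrite lecE => /andP[].
- by move=> i; rewrite -Re_sum unitary_sum_row.
- by move=> j; rewrite -Re_sum unitary_sum_col.
Qed.

End Spectral.

(** * Majorization through the excess function *)

Section Excess.
Variable R : realType.
Implicit Types (s x y : seq R) (t : R).

Definition excess s t : R := \sum_(z <- s) Num.max (z - t) 0.

Lemma excess_ord d (p : d.-tuple R) t :
  excess p t = \sum_(i < d) Num.max (p`_i - t) 0.
Proof. by rewrite /excess (big_nth 0) size_tuple big_mkord. Qed.

Lemma excess_ge0 s t : 0 <= excess s t.
Proof. by apply: sumr_ge0 => z _; rewrite le_max lexx orbT. Qed.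

Lemma sum_le_excess s t k : (k <= size s)%N ->
  \sum_(j < k) s`_j <= k%:R * t + excess s t.
Proof.
move=> ks; rewrite /excess (big_nth 0) (big_cat_nat (n := k)) //= addrA.
apply: ler_wpDr; first by apply: sumr_ge0 => j _; rewrite le_max lexx orbT.
rewrite big_mkord -[k in k%:R]card_ord mulr_natl -sumr_const -big_split /=.
by apply: ler_sum => j _; rewrite -lerBlDl le_max lexx.
Qed.

Lemma sorted_nth_le s i j : sorted >=%R s -> (i <= j < size s)%N ->
  s`_j <= s`_i.
Proof.
move=> ss /andP[ij js].
apply: (sorted_leq_nth _ _ 0 ss) => //; rewrite ?inE ?(leq_ltn_trans ij) //.
  by move=> a b c /= ba cb; apply: le_trans cb ba.
by move=> a /=.
Qed.

(** At the level of the [k]-th entry, the first [k] entries lie above and the others below, so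
    [sum_le_excess] becomes an equality. *)
Lemma excess_sorted s k : sorted >=%R s -> (0 < k <= size s)%N ->
  \sum_(j < k) s`_j = k%:R * s`_k.-1 + excess s s`_k.-1.
Proof.
move=> ss /andP[k0 ks]; rewrite /excess (big_nth 0) (big_cat_nat (n := k)) //=.
rewrite [X in _ + (_ + X)]big_nat_cond [X in _ + (_ + X)]big1 ?addr0;
  last first.
  move=> j; rewrite andbT => /andP[kj js]; apply/max_idPr; rewrite subr_le0.
  by apply: sorted_nth_le => //; rewrite js (leq_trans (leq_pred k)).
rewrite big_mkord -[k in k%:R]card_ord mulr_natl -sumr_const -big_split /=.
apply: eq_bigr => j _.
have /max_idPl -> : 0 <= s`_j - s`_k.-1; last by rewrite addrC subrK.
rewrite subr_ge0; apply: sorted_nth_le => //.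
by rewrite -ltnS prednK // ltn_ord (leq_trans _ ks) // prednK.
Qed.

Lemma sort_ge_sorted s : sorted >=%R (sort >=%R s).
Proof. by apply: sort_sorted => a b; exact: le_total. Qed.

Lemma excess_sort s t : excess (sort >=%R s) t = excess s t.
Proof. by apply: perm_big; rewrite perm_sort. Qed.

(* [\sum_(j < k) s_j] is the minimum over [t] of [k t + excess s t], for [s]
   sorted; this is the dual form of majorization. *)
Lemma excess_majorized d (y x : d.-tuple R) :
  \sum_(j < d) y`_j = \sum_(j < d) x`_j ->
  (forall t, excess y t <= excess x t) -> majorized y x.
Proof.
move=> yx H; split=> // k /andP[k0 kd].
have kd' : (k <= d)%N by apply: leq_trans kd (leq_pred d).
rewrite [leRHS]excess_sorted ?sort_ge_sorted ?size_sort ?size_tuple ?k0 //.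
apply: le_trans (sum_le_excess (sort >=%R x)`_k.-1 _) _.
  by rewrite size_sort size_tuple.
by rewrite lerD2l !excess_sort.
Qed.

(** Jensen's inequality for the convex function [z |-> max (z - t) 0]. *)
Lemma stochastic_excess d (w : 'I_d -> R) (p : d.-tuple R) t :
  (forall j, 0 <= w j) -> \sum_j w j = 1 ->
  Num.max (\sum_j w j * p`_j - t) 0 <= \sum_j w j * Num.max (p`_j - t) 0.
Proof.
move=> w0 w1; rewrite ge_max; apply/andP; split; last first.
  by apply: sumr_ge0 => j _; rewrite mulr_ge0 // le_max lexx orbT.
rewrite -{1}[t]mul1r -w1 mulr_suml -sumrB; apply: ler_sum => j _.
by rewrite -mulrBr ler_wpM2l // le_max lexx.
Qed.

Lemma stochastic_norm d (w : 'I_d -> R) (p : d.-tuple R) :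
  (forall j, 0 <= w j) ->
  `|\sum_j w j * p`_j| <= \sum_j w j * `|p`_j|.
Proof.
move=> w0; apply: le_trans (ler_norm_sum _ _ _) _.
by apply: ler_sum => j _; rewrite normrM ger0_norm.
Qed.

Lemma sum_doubly_stochastic d (W : 'I_d -> 'I_d -> R) (g : 'I_d -> R) :
  (forall j, \sum_i W i j = 1) -> \sum_i \sum_j W i j * g j = \sum_j g j.
Proof.
move=> W1; rewrite exchange_big; apply: eq_bigr => j _.
by rewrite -mulr_suml W1 mul1r.
Qed.

(** Summation of [|z| + z = 2 max z 0]. *)
Lemma sum_max0 (I : finType) (f : I -> R) : \sum_i f i = 0 ->
  \sum_i Num.max (f i) 0 = 2^-1 * \sum_i `|f i|.
Proof.
move=> f0; have <- : \sum_i (`|f i| + f i) = \sum_i `|f i|.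
  by rewrite big_split /= f0 addr0.
rewrite mulr_sumr; apply: eq_bigr => i _.
by case: (ger0P (f i)) => h; lra.
Qed.

End Excess.

(** * Diagonals, trace norms and density matrices *)

Section DensityMatrices.
Local Open Scope sesquilinear_scope.
Variables (R : realType) (d : nat).
Local Notation op := 'M[R[i]]_d.
Implicit Types (U V A B : op) (p q : d.-tuple R) (e : 'I_d -> 'cV[R[i]]_d).

Lemma diag_in_spectral A i : A \is hermsymmx ->
  diag_in (spectralmx A) A i = (eigenvalues A)`_i.
Proof.
move=> Ah; rewrite {2}(hermitian_unitary_diag Ah).
exact/diag_in_eigenbasis/spectral_unitarymx.
Qed.

Lemma trace_norm_eigenvalues A : A \is hermsymmx ->
  trace_norm A = \sum_(i < d) `|(eigenvalues A)`_i|.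
Proof.
move=> Ah; rewrite {1}(hermitian_unitary_diag Ah).
exact/trace_norm_unitary_diag/spectral_unitarymx.
Qed.

(** Jensen's inequality in each row of the doubly stochastic matrix, then summation over its
    columns. This is Schur's theorem, that the spectrum majorizes the diagonal, in terms of the
    excess. *)
Lemma excess_diag_in U A t : A \is hermsymmx -> U \is unitarymx ->
  \sum_i Num.max (diag_in U A i - t) 0 <= excess (eigenvalues A) t.
Proof.
move=> Ah Uu; have [W [W0 Wr Wc E]] :=
  diag_in_doubly_stochastic (eigenvalues A) Uu (spectral_unitarymx A).
rewrite -hermitian_unitary_diag // in E.
rewrite excess_ord -[leRHS](sum_doubly_stochastic _ Wc).
by apply: ler_sum => i _; rewrite E stochastic_excess.
Qed.

Lemma norm_diag_in U A : A \is hermsymmx -> U \is unitarymx ->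
  \sum_i `|diag_in U A i| <= trace_norm A.
Proof.
move=> Ah Uu; rewrite trace_norm_eigenvalues //.
have [W [W0 Wr Wc E]] := diag_in_doubly_stochastic (eigenvalues A) Uu
  (spectral_unitarymx A).
rewrite -hermitian_unitary_diag // in E.
rewrite -[leRHS](sum_doubly_stochastic _ Wc).
by apply: ler_sum => i _; rewrite E stochastic_norm.
Qed.

Lemma hermsymmxE A : (A \is hermsymmx) = (A == A^t*).
Proof. by rewrite qualifE /= expr0 scale1r. Qed.

Lemma hermsymmx_lin (a b : R) A B : A \is hermsymmx -> B \is hermsymmx ->
  a%:C *: A + b%:C *: B \is hermsymmx.
Proof.
rewrite !hermsymmxE => /eqP Ah /eqP Bh.
rewrite linearD !linearZ /= map_mxD !map_mxZ /= -Ah -Bh.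
by rewrite !(conjC_real (R := R)).
Qed.

Lemma hermsymmxB A B : A \is hermsymmx -> B \is hermsymmx ->
  A - B \is hermsymmx.
Proof.
move=> Ah Bh; have := hermsymmx_lin 1 (-1) Ah Bh.
by rewrite rmorphN1 scaleN1r rmorph1 scale1r.
Qed.

(** In an eigenbasis of the combination, its trace norm is the sum of the moduli of the diagonal,
    where the triangle inequality applies entrywise; [norm_diag_in] bounds the two resulting sums.
    This yields convexity of the ball. *)
Lemma trace_norm_lin (a b : R) A B : A \is hermsymmx -> B \is hermsymmx ->
  0 <= a -> 0 <= b ->
  trace_norm (a%:C *: A + b%:C *: B) <= a * trace_norm A + b * trace_norm B.
Proof.
move=> Ah Bh a0 b0; set X := _ + _.
have Xh : X \is hermsymmx by apply: hermsymmx_lin.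
have Uu := spectral_unitarymx X.
rewrite (trace_norm_eigenvalues Xh).
apply: le_trans (lerD (ler_wpM2l a0 (norm_diag_in Ah Uu))
  (ler_wpM2l b0 (norm_diag_in Bh Uu))).
rewrite !mulr_sumr -big_split /=; apply: ler_sum => i _.
rewrite -diag_in_spectral // {1}/X diag_inD !diag_inZ.
apply: le_trans (ler_normD _ _) _; rewrite !normrM.
by rewrite (ger0_norm a0) (ger0_norm b0).
Qed.

Lemma trace_normN A : trace_norm (- A) = trace_norm A.
Proof.
have E : (- A)^t* *m - A = A^t* *m A.
  have -> : (- A)^t* = - A^t* by apply/matrixP => i j; rewrite !mxE rmorphN.
  by rewrite mulNmx mulmxN opprK.
by rewrite /trace_norm /absmx E.
Qed.

Lemma trace_normBC A B : trace_norm (A - B) = trace_norm (B - A).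
Proof. by rewrite -trace_normN opprB. Qed.

(* The positive part of a traceless Hermitian operator carries exactly half of
   its trace norm. *)
Lemma excess_trace_norm A B t : A \is hermsymmx -> B \is hermsymmx ->
  \tr A = \tr B ->
  excess (eigenvalues A) t
    <= excess (eigenvalues B) t + 2^-1 * trace_norm (A - B).
Proof.
move=> Ah Bh trAB; have Uu := spectral_unitarymx A.
have h0 : 0 <= 2^-1 :> R by rewrite invr_ge0.
apply: le_trans (lerD (excess_diag_in t Bh Uu)
  (ler_wpM2l h0 (norm_diag_in (hermsymmxB Ah Bh) Uu))).
have s0 : \sum_i diag_in (spectralmx A) (A - B) i = 0.
  by rewrite sum_diag_in // linearB /= trAB subrr.
rewrite -(sum_max0 s0) excess_ord -big_split /=; apply: ler_sum => i _.
rewrite -diag_in_spectral // diag_inB.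
move: (diag_in _ A i) (diag_in _ B i) => a b; clear.
by case: (lerP (a - t) 0); case: (lerP (b - t) 0); case: (lerP (a - b) 0); lra.
Qed.

(** The quadratic form at [v] is the sum of [p_i] times the squared modulus of the [i]-th coordinate
    of [V v]. *)
Lemma unitary_diag_psd V p : (forall i, (i < d)%N -> 0 <= p`_i) ->
  psdmx (unitary_diag V p).
Proof.
move=> p0; split; first exact: unitary_diag_hermitian.
move=> v; rewrite /unitary_diag !mulmxA.
set w := V *m v; have -> : v^t* *m V^t* = w^t* by rewrite /w trmx_mul map_mxM.
rewrite -mulmxA -/w mul_mx_diag mxE; apply: sumr_ge0 => i _.
rewrite !mxE mulrAC -normCKC; apply: mulr_ge0; first exact: exprn_ge0.
by rewrite ler0c p0.
Qed.

Lemma unitary_diag_density V p : V \is unitarymx ->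
  (forall i, (i < d)%N -> 0 <= p`_i) -> \sum_(i < d) p`_i = 1 ->
  density (unitary_diag V p).
Proof.
move=> Vu p0 p1; split; first exact: unitary_diag_psd.
by rewrite trace_unitary_diag // p1.
Qed.

(** The entry is the quadratic form of [A] at the adjoint of the [i]-th row of [U]. *)
Lemma diag_in_psd_ge0 U A i : psdmx A -> 0 <= diag_in U A i.
Proof.
case=> _ /= H; move: {H}(H ((row i U)^t*)); rewrite trmxCK lecE /diag_in.
have -> : (U *m A *m U^t*) i i = (row i U *m A *m (row i U)^t*) ord0 ord0.
  by rewrite -row_mul [LHS]mxE [RHS]mxE; apply: eq_bigr => j _; rewrite !mxE.
by case/andP.
Qed.

Lemma density_spectrum V p : V \is unitarymx -> density (unitary_diag V p) ->
  (forall i, (i < d)%N -> 0 <= p`_i) /\ \sum_(i < d) p`_i = 1.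
Proof.
move=> Vu [Ap]; rewrite trace_unitary_diag // => /complexI p1; split=> // i id.
rewrite -(diag_in_eigenbasis p (Ordinal id) Vu); exact: diag_in_psd_ge0.
Qed.

Lemma density_eigenvalues A : density A ->
  (forall i, (i < d)%N -> 0 <= (eigenvalues A)`_i) /\
  \sum_(i < d) (eigenvalues A)`_i = 1.
Proof.
move=> Ad; have Ah := Ad.1.1; apply: density_spectrum (spectral_unitarymx A) _.
by rewrite -hermitian_unitary_diag.
Qed.

(** The rows are the adjoints of the vectors [e i], so that for an orthonormal [e] the matrix sends
    [e i] to the [i]-th coordinate vector. *)
Definition basis_mx e : op := \matrix_(i, j) Num.conj (e i j ord0).

Lemma basis_mx_unitary e : orthonormal_basis e -> basis_mx e \is unitarymx.
Proof.
move=> eo; apply/unitarymxP/matrixP => i j.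
have := congr1 (fun M : 'M_1 => M ord0 ord0) (eo i j).
rewrite !mxE eqxx mulr1n => <-.
by apply: eq_bigr => k _; rewrite !mxE conjCK.
Qed.

Lemma diagonal_opE e p : diagonal_op e p = unitary_diag (basis_mx e) p.
Proof.
apply/matrixP => i j; rewrite /diagonal_op /unitary_diag mul_mx_diag summxE mxE.
apply: eq_bigr => k _; rewrite !mxE big_ord1 !mxE conjCK; ring.
Qed.

Lemma unitary_diagB V p q : unitary_diag V p - unitary_diag V q =
  unitary_diag V [tuple p`_i - q`_i | i < d].
Proof.
rewrite /unitary_diag.
have -> : complex_row [tuple p`_i - q`_i | i < d] =
    complex_row p - complex_row q.
  by apply/rowP => i; rewrite !mxE nth_mktuple rmorphB.
by rewrite linearB /= mulmxBr mulmxBl.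
Qed.

Lemma trace_norm_unitary_diagB V p q : V \is unitarymx ->
  trace_norm (unitary_diag V p - unitary_diag V q) =
  \sum_(i < d) `|p`_i - q`_i|.
Proof.
move=> Vu; rewrite unitary_diagB trace_norm_unitary_diag //.
by apply: eq_bigr => i _; rewrite nth_mktuple.
Qed.

Lemma max_mixed_unitary_diag V : V \is unitarymx ->
  max_mixed R d = unitary_diag V [tuple d%:R^-1 | _ < d].
Proof.
move=> Vu; rewrite /unitary_diag.
have -> : diag_mx (complex_row [tuple d%:R^-1 | _ < d]) = max_mixed R d.
  apply/matrixP => i j; rewrite !mxE nth_mktuple fmorphV rmorph_nat //.
rewrite /max_mixed mul_mx_scalar -scalemxAl -invmx_unitary //.
by rewrite mulVmx ?unitarymx_unit // scalemx1.
Qed.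

End DensityMatrices.

(** * The flattened and the steepened spectrum *)

Ltac nat_lia :=
  repeat match goal with
  | H : is_true (leq _ _) |- _ => revert H
  | H : is_true (andb _ _) |- _ => revert H
  | H : is_true (negb _) |- _ => revert H
  | H : @eq ?T ?a ?b |- _ => unify T nat; revert H
  end; clear; intros; lia.

(** * Clamping a number between two levels *)

Section Clamp.
Variables (R : realType) (a1 a2 : R).

(** Clamping adds the deficit below [a1] and removes the excess above [a2]; at most one of the two
    is nonzero. *)
Lemma clamp_sub z : a1 < a2 -> Num.max a1 (Num.min z a2) =
  z + (Num.max (a1 - z) 0 - Num.max (z - a2) 0).
Proof.
move=> a12; case: (lerP z a2) => h2;
  [case: (lerP a1 z) => h1|case: (lerP a1 a2) => h1];
  by case: (lerP (a1 - z) 0) => ?; case: (lerP (z - a2) 0) => ?; lra.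
Qed.

Lemma clamp_dist z : a1 < a2 -> `|Num.max a1 (Num.min z a2) - z| =
  Num.max (a1 - z) 0 + Num.max (z - a2) 0.
Proof.
move=> a12; rewrite clamp_sub // (addrC z) addrK.
case: (lerP (a1 - z) 0) => h1; case: (lerP (z - a2) 0) => h2;
  by case: ger0P => h3; lra.
Qed.

(** Seen from a level [t] between [a1] and [a2], clamping removes the part of [z] above [a2], while
    values raised to [a1] stay below [t]. *)
Lemma clamp_excess z t : a1 < t < a2 ->
  Num.max (Num.max a1 (Num.min z a2) - t) 0 + Num.max (z - a2) 0
    <= Num.max (z - t) 0.
Proof.
case/andP=> a1t ta2; rewrite clamp_sub ?(lt_trans a1t) //.
rewrite -lerBrDr ge_max.
case: (lerP (a1 - z) 0) => h1; case: (lerP (z - a2) 0) => h2;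
  by case: (lerP (z - t) 0) => h3; lra.
Qed.

End Clamp.

Section Spectra.
Variables (R : realType) (d : nat) (mu : d.-tuple R) (eps : R).
Hypothesis d_ge2 : (2 <= d)%N.
Hypothesis mu_sorted : sorted >=%R mu.
Hypothesis mu_ge0 : forall i, (i < d)%N -> 0 <= mu`_i.
Hypothesis mu_sum : \sum_(i < d) mu`_i = 1.
Hypothesis eps_gt0 : 0 < eps.

Lemma mu_le i j : (i <= j)%N -> (j < d)%N -> mu`_j <= mu`_i.
Proof. by move=> ij jd; apply: sorted_nth_le => //; rewrite ij size_tuple. Qed.

Lemma mu_le1 i : (i < d)%N -> mu`_i <= 1.
Proof.
move=> id; rewrite -mu_sum (bigD1 (Ordinal id)) //= lerDl.
by apply: sumr_ge0 => j _; apply: mu_ge0.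
Qed.

(** Take the least [n] with [eps <= h n]; it is positive because [h 0 < eps]. *)
Lemma crossing (h : nat -> R) N : h 0%N < eps -> eps <= h N ->
  exists n, [/\ (1 <= n <= N)%N, h n.-1 < eps & eps <= h n].
Proof.
move=> h0 hN; have ex : exists n, eps <= h n by exists N.
case: (ex_minnP ex) => -[|n] hn minn; first by rewrite leNgt h0 in hn.
exists n.+1; rewrite ltn0Sn minn //; split=> //=.
by rewrite ltNge; apply/negP => /minn; rewrite ltnn.
Qed.

(** * Levels and flattened spectrum away from the maximally mixed state *)

Section Levels.
Hypothesis far : eps < 2^-1 * \sum_(i < d) `|mu`_i - d%:R^-1|.

Let dR_gt0 : 0 < d%:R :> R.
Proof. by rewrite ltr0n; nat_lia. Qed.

Lemma centered : \sum_(i < d) (mu`_i - d%:R^-1) = 0.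
Proof.
rewrite sumrB mu_sum sumr_const card_ord -(mulr_natr d%:R^-1).
by rewrite mulVf ?gt_eqF // subrr.
Qed.

(** The deviations from the mean sum to zero, so their positive parts make up half of the l1
    distance, which exceeds [eps] by [far]. *)
Lemma far_excess : eps < excess mu d%:R^-1.
Proof. by rewrite excess_ord (sum_max0 centered). Qed.

Lemma far_deficit : eps < \sum_(i < d) Num.max (d%:R^-1 - mu`_i) 0.
Proof.
rewrite (sum_max0 (f := fun i : 'I_d => d%:R^-1 - mu`_i)).
  by under eq_bigr do rewrite distrC.
by under eq_bigr do rewrite -opprB; rewrite sumrN centered oppr0.
Qed.

(** [h m] is the mass removed when the first [m] entries are lowered to the next one. It starts at 0
    and reaches [eps] at [d - 1]; at the first index where it does, the level solves a linear
    equation. *)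
Lemma upper_cut_exists : exists am, upper_cut mu eps am.
Proof.
pose h m := \sum_(0 <= i < m) (mu`_i - mu`_m).
have min_le : mu`_d.-1 <= d%:R^-1.
  rewrite -[leRHS]mul1r ler_pdivlMr // -[leRHS]mu_sum mulr_natr.
  rewrite -[X in _ *+ X]card_ord -sumr_const; apply: ler_sum => i _.
  by apply: mu_le; have := ltn_ord i; nat_lia.
have hd : eps <= h d.-1.
  (* As the smallest entry is at most the mean [1/d], each term of the excess at [1/d] is at most
     the distance to the smallest entry. *)
  apply: le_trans (ltW far_excess) _; rewrite excess_ord.
  rewrite -(big_mkord xpredT (fun i => Num.max (mu`_i - d%:R^-1) 0)).
  rewrite (big_cat_nat (n := d.-1)) ?leq_pred //=.
  rewrite [X in _ + X]big_ltn; last nat_lia.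
  rewrite [\sum_(d.-1.+1 <= i < d) _]big_geq ?addr0; last nat_lia.
  have -> : Num.max (mu`_d.-1 - d%:R^-1) 0 = 0.
    by apply/max_idPr; rewrite subr_le0.
  rewrite addr0; apply: ler_sum_nat => i /andP[_ id].
  rewrite ge_max subr_ge0 mu_le ?andbT; [|nat_lia|nat_lia].
  by rewrite lerD2l lerN2.
have h0 : h 0%N < eps by rewrite /h big_geq.
have [k [/andP[m1 md] lo hi]] := crossing h0 hd.
case: k m1 md lo hi => [//|m] m1 md /= lo hi.
have m0 : 0 < m.+1%:R :> R by rewrite ltr0n.
pose T := \sum_(0 <= i < m.+1) mu`_i.
have hE c : \sum_(0 <= i < m.+1) (mu`_i - c) = T - m.+1%:R * c.
  by rewrite sumrB sumr_const_nat subn0 mulr_natl.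
have am : mu`_m.+1 <= (T - eps) / m.+1%:R.
  by rewrite ler_pdivlMr //; move: hi; rewrite /h hE; lra.
have ap : (T - eps) / m.+1%:R < mu`_m.
  (* With the vanishing term of index [m] added, [h m] is a sum over the same range as [T], so
     [h m < eps] bounds the level. *)
  rewrite ltr_pdivrMr //; have := hE mu`_m.
  by rewrite big_nat_recr //= subrr addr0; move: lo; rewrite /h; lra.
have mud i : (i < m.+1)%N -> mu`_m <= mu`_i by move=> im; apply: mu_le; nat_lia.
exists ((T - eps) / m.+1%:R, m.+1); split; [|nat_lia| |by rewrite am].
  apply/andP; split; first by apply: le_trans am; apply: mu_ge0; nat_lia.
  by apply: le_trans (ltW ap) _; apply: mu_le1; nat_lia.
transitivity (\sum_(0 <= i < m.+1) (mu`_i - (T - eps) / m.+1%:R)).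
  apply: eq_big_nat => i /andP[_ im]; rewrite distrC ger0_norm // subr_ge0.
  exact: le_trans (ltW ap) (mud i im).
by rewrite hE mulrC divfK ?gt_eqF //; lra.
Qed.

(** Mirror image of [upper_cut_exists]: [h n] is the mass needed to raise the last [n] entries to
    the one just before them. *)
Lemma lower_cut_exists : exists an, lower_cut mu eps an.
Proof.
pose h n := \sum_(d - n <= i < d) (mu`_(d - n).-1 - mu`_i).
have max_ge : d%:R^-1 <= mu`_0.
  rewrite -[leLHS]mul1r ler_pdivrMr // -[leLHS]mu_sum mulr_natr.
  rewrite -[X in _ *+ X]card_ord -sumr_const; apply: ler_sum => i _.
  by apply: mu_le.
have hd : eps <= h d.-1.
  apply: le_trans (ltW far_deficit) _.
  rewrite -(big_mkord xpredT (fun i => Num.max (d%:R^-1 - mu`_i) 0)).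
  rewrite /h (_ : d - d.-1 = 1)%N; last nat_lia.
  rewrite big_ltn; last nat_lia.
  have -> : Num.max (d%:R^-1 - mu`_0) 0 = 0 by apply/max_idPr; rewrite subr_le0.
  rewrite add0r; apply: ler_sum_nat => i /andP[_ id].
  by rewrite ge_max subr_ge0 mu_le // andbT lerD2r.
have h0 : h 0%N < eps by rewrite /h subn0 big_geq.
have [n [/andP[n1 nd] lo hi]] := crossing h0 hd.
have n0 : 0 < n%:R :> R by rewrite ltr0n.
pose T := \sum_(d - n <= i < d) mu`_i.
have hE c : \sum_(d - n <= i < d) (c - mu`_i) = n%:R * c - T.
  by rewrite sumrB sumr_const_nat mulr_natl (_ : d - (d - n) = n)%N //; nat_lia.
have am : (T + eps) / n%:R <= mu`_(d - n).-1.
  by rewrite ler_pdivrMr //; move: hi; rewrite /h hE; lra.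
have ap : mu`_(d - n) < (T + eps) / n%:R.
  rewrite ltr_pdivlMr //; have := hE mu`_(d - n).
  (* The term of index [d - n] vanishes, which leaves [h n.-1]. *)
  rewrite big_ltn ?subrr ?add0r; last nat_lia.
  move: lo; rewrite /h (_ : d - n.-1 = (d - n).+1)%N /=; last nat_lia.
  lra.
have mud i : (d - n <= i < d)%N -> mu`_i <= mu`_(d - n).
  by move=> /andP[ni id]; apply: mu_le.
exists ((T + eps) / n%:R, n); split; [|nat_lia| |by rewrite am ap].
  apply/andP; split; first by apply: le_trans (ltW ap); apply: mu_ge0; nat_lia.
  by apply: le_trans am _; apply: mu_le1; nat_lia.
transitivity (\sum_(d - n <= i < d) ((T + eps) / n%:R - mu`_i)).
  apply: eq_big_nat => i id; rewrite ger0_norm // subr_ge0.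
  exact: le_trans (mud i id) (ltW ap).
by rewrite hE mulrC divfK ?gt_eqF //; lra.
Qed.

(** The first [m] entries exceed [a] and the others do not, so the equation defining the cut is one
    for the excess. *)
Lemma upper_cut_excess a m : upper_cut mu eps (a, m) -> excess mu a = eps.
Proof.
case=> _ md <- /andP[am ap].
rewrite excess_ord -(big_mkord xpredT (fun i => Num.max (mu`_i - a) 0)).
rewrite (big_cat_nat (n := m)) //=; last nat_lia.
rewrite [X in _ + X]big_nat_cond [X in _ + X]big1 ?addr0; last first.
  move=> i; rewrite andbT => /andP[mi id]; apply/max_idPr; rewrite subr_le0.
  by apply: le_trans am; apply: mu_le.
apply: eq_big_nat => i /andP[_ im].
have : mu`_m.-1 <= mu`_i by apply: mu_le; nat_lia.
by case: (ger0P (a - mu`_i)); case: (lerP (mu`_i - a) 0); lra.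
Qed.

Lemma lower_cut_deficit a n : lower_cut mu eps (a, n) ->
  \sum_(i < d) Num.max (a - mu`_i) 0 = eps.
Proof.
case=> _ nd <- /andP[am ap].
rewrite -(big_mkord xpredT (fun i => Num.max (a - mu`_i) 0)).
rewrite (big_cat_nat (n := (d - n)%N)) //=; last nat_lia.
rewrite [X in X + _]big_nat_cond [X in X + _]big1 ?add0r; last first.
  move=> i; rewrite andbT => /andP[_ id]; apply/max_idPr; rewrite subr_le0.
  by apply: le_trans ap _; apply: mu_le; nat_lia.
apply: eq_big_nat => i /andP[ni id].
have : mu`_i <= mu`_(d - n) by apply: mu_le.
by case: (ger0P (a - mu`_i)); lra.
Qed.

(** Turns the definition by indices into a clamp, for which the sum, the distance to [mu] and the
    excess are treated entry by entry. *)
Lemma levels_clamp : exists a1 a2 : R,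
  [/\ a1 < d%:R^-1 < a2, 0 <= a1, excess mu a2 = eps,
      \sum_(i < d) Num.max (a1 - mu`_i) 0 = eps
    & forall i, (i < d)%N ->
        (flattened_spectrum mu eps)`_i = Num.max a1 (Num.min mu`_i a2)].
Proof.
(* Both conditions are satisfiable, so [xget] does not fall back on its default. *)
have := xgetPex (0, 0%N) upper_cut_exists.
have := xgetPex (0, 0%N) lower_cut_exists.
rewrite -/(lower_level mu eps) -/(upper_level mu eps).
rewrite /flattened_spectrum.
case: (lower_level mu eps) => a1 n; case: (upper_level mu eps) => a2 m /= L U.
have Ue := upper_cut_excess U; have Le := lower_cut_deficit L.
(* The deficit is nondecreasing in the level and the excess nonincreasing, so [far_deficit] and
   [far_excess] place the levels on the two sides of [1/d]. *)
have a1d : a1 < d%:R^-1.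
  rewrite ltNge; apply/negP => da; have := far_deficit; rewrite -Le ltNge.
  move/negP; apply; apply: ler_sum => i _.
  by rewrite ge_max !le_max lexx orbT andbT lerD2r da.
have a2d : d%:R^-1 < a2.
  rewrite ltNge; apply/negP => da; have := far_excess; rewrite -Ue ltNge.
  move/negP; apply; rewrite !excess_ord; apply: ler_sum => i _.
  by rewrite ge_max !le_max lexx orbT andbT lerD2l lerN2 da.
exists a1, a2; rewrite a1d a2d; split=> //; first by case: L => /andP[].
case: L => _ nd _ /andP[n1 n2]; case: U => _ md _ /andP[m1 m2] i id.
have -> : [tuple if (j < m)%N then a2 else if (j < d - n)%N then mu`_j else a1
    | j < d]`_i = if (i < m)%N then a2 else if (i < d - n)%N then mu`_i else a1.
  by rewrite (nth_mktuple _ _ (Ordinal id)).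
have a12 : a1 < a2 by apply: lt_trans a1d a2d.
case: ltnP => im.
  have h : mu`_m.-1 <= mu`_i by apply: mu_le; nat_lia.
  by rewrite (min_idPr _) ?(max_idPr _) //; lra.
have h : mu`_i <= mu`_m by apply: mu_le.
rewrite (min_idPl _); last lra.
case: ltnP => ni.
  have h' : mu`_(d - n).-1 <= mu`_i by apply: mu_le; nat_lia.
  by rewrite (max_idPr _) //; lra.
have h' : mu`_i <= mu`_(d - n) by apply: mu_le.
by rewrite (max_idPl _) //; lra.
Qed.

Lemma flattened_ge0 i : (i < d)%N -> 0 <= (flattened_spectrum mu eps)`_i.
Proof.
have [a1 [a2 [_ a10 _ _ E]]] := levels_clamp.
by move=> id; rewrite E // le_max a10.
Qed.

Lemma flattened_sum : \sum_(i < d) (flattened_spectrum mu eps)`_i = 1.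
Proof.
have [a1 [a2 [/andP[a1d a2d] _ Ue Le E]]] := levels_clamp.
under eq_bigr do rewrite E // (clamp_sub _ (lt_trans a1d a2d)).
by rewrite big_split sumrB /= Le -excess_ord Ue mu_sum subrr addr0.
Qed.

Lemma flattened_dist :
  \sum_(i < d) `|(flattened_spectrum mu eps)`_i - mu`_i| = 2 * eps.
Proof.
have [a1 [a2 [/andP[a1d a2d] _ Ue Le E]]] := levels_clamp.
under eq_bigr do rewrite E // (clamp_dist _ (lt_trans a1d a2d)).
by rewrite big_split /= Le -excess_ord Ue; lra.
Qed.

Lemma flattened_excess_le (w : d.-tuple R) t : \sum_(i < d) w`_i = 1 ->
  excess mu t <= excess w t + eps ->
  excess (flattened_spectrum mu eps) t <= excess w t.
Proof.
move=> w1 wt; have [a1 [a2 [/andP[a1d a2d] _ Ue Le E]]] := levels_clamp.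
have [ta1|a1t] := leP t a1.
  (* Every flattened entry is at least [t], so its excess is a plain sum, equal to the corresponding
     sum for [w], which is at most the excess of [w]. *)
  apply: (@le_trans _ _ (\sum_(i < d) (w`_i - t))).
    rewrite sumrB w1 -flattened_sum -sumrB excess_ord; apply: ler_sum => i _.
    by rewrite ge_max lexx subr_ge0 E // le_max ta1.
  by rewrite excess_ord; apply: ler_sum => i _; rewrite le_max lexx.
have [a2t|ta2] := leP a2 t.
  rewrite {1}excess_ord big1 ?excess_ge0 // => i _; apply/max_idPr.
  by rewrite subr_le0 E // ge_max (ltW a1t) ge_min a2t orbT.
(* Writing the added [eps] as the excess of [mu] at [a2] reduces the claim to [clamp_excess], entry
   by entry. *)
rewrite -(lerD2r eps); apply: le_trans wt; rewrite -[X in _ + X <= _]Ue.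
rewrite !excess_ord -big_split.
apply: ler_sum => i _; rewrite E //=; by apply: clamp_excess; rewrite a1t.
Qed.

End Levels.

(** * Partial sums of the steepened spectrum *)

Definition head_sum k := \sum_(0 <= i < k) mu`_i.

(* The steepened spectrum has the largest partial sums allowed by normalization
   and by the ball: see [steepened_diff]. *)
Definition steep_sum k := if k is 0 then 0 else Num.min 1 (head_sum k + eps).
Arguments steep_sum : simpl never.

Lemma steep_sum0 : steep_sum 0%N = 0. Proof. by []. Qed.

Lemma head_sumS k : head_sum k.+1 = head_sum k + mu`_k.
Proof. by rewrite /head_sum big_nat_recr. Qed.

Lemma head_sum1 : head_sum 1%N = mu`_0.
Proof. by rewrite head_sumS /head_sum big_geq // add0r. Qed.

Lemma head_sum_full : head_sum d = 1.
Proof. by rewrite /head_sum big_mkord. Qed.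

Lemma head_sum_le k l : (k <= l)%N -> (l <= d)%N -> head_sum k <= head_sum l.
Proof.
move=> kl ld; rewrite /head_sum (big_cat_nat (n := k) (p := l)) //= lerDl.
rewrite big_nat_cond; apply: sumr_ge0 => i; rewrite andbT => ?.
by apply: mu_ge0; nat_lia.
Qed.

Lemma tail_sumE l : (l <= d)%N -> tail_sum mu l = 1 - head_sum (d - l).
Proof.
move=> ld; rewrite -head_sum_full /head_sum (big_cat_nat (n := (d - l)%N)) //=.
  by rewrite addrC addrK.
exact: leq_subr.
Qed.

(** The maximum is attained because the length 1 is admissible: the last entry is at most [eps]. *)
Lemma cut_lengthP : mu`_d.-1 <= eps ->
  [/\ (0 < cut_length mu eps < d)%N, tail_sum mu (cut_length mu eps) <= eps
    & forall l, (cut_length mu eps < l < d)%N -> eps < tail_sum mu l].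
Proof.
move=> le_eps; have d1 : (1 < d)%N by [].
pose P := fun l : 'I_d => (0 < l)%N && (tail_sum mu l <= eps).
have P1 : P (Ordinal d1).
  rewrite /P /= /tail_sum (_ : d - 1 = d.-1)%N; last nat_lia.
  by rewrite big_ltn ?big_geq ?addr0 //; nat_lia.
have /(eq_bigmax_cond (fun l : 'I_d => l : nat))[l Pl E] : (0 < #|P|)%N.
  by apply/card_gt0P; exists (Ordinal d1).
rewrite /cut_length E; move: Pl; rewrite unfold_in => /andP[l0 lt].
split=> //; first by rewrite l0 ltn_ord.
move=> k /andP[lk kd]; rewrite ltNge; apply/negP => kt.
have Pk : P (Ordinal kd) by rewrite /P /= kt andbT; nat_lia.
have := @leq_bigmax_cond _ P (fun l : 'I_d => l : nat) _ Pk.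
by rewrite E /= leqNgt lk.
Qed.

Lemma steep_sum_low k : (0 < k)%N -> head_sum k + eps <= 1 ->
  steep_sum k = head_sum k + eps.
Proof. by case: k => // k _ h; apply/min_idPr. Qed.

Lemma steep_sum_high k : (0 < k)%N -> 1 <= head_sum k + eps ->
  steep_sum k = 1.
Proof. by case: k => // k _ h; apply/min_idPl. Qed.

(** The cap at 1 in [steep_sum] is reached once the remaining tail weighs at most [eps]: only at
    [k = d] if the last entry exceeds [eps], otherwise from [k = d - cut_length] on. Each branch of
    the definition is then a difference of two explicit values. *)
Lemma steepened_diff i : (i < d)%N ->
  (steepened_spectrum mu eps)`_i = steep_sum i.+1 - steep_sum i.
Proof.
move=> id; rewrite /steepened_spectrum; case: ltP => [lt_eps|le_eps].
  rewrite (nth_mktuple _ _ (Ordinal id)) /=.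
  have dS : d.-1.+1 = d by nat_lia.
  have hd : head_sum d.-1 + mu`_d.-1 = 1 by rewrite -head_sumS dS head_sum_full.
  have low k : (0 < k < d)%N -> steep_sum k = head_sum k + eps.
    move=> kd; apply: steep_sum_low; first nat_lia.
    have : head_sum k <= head_sum d.-1 by apply: head_sum_le; nat_lia.
    lra.
  case: eqP => [->|/eqP i0].
    by rewrite [steep_sum 1%N]low ?head_sum1 ?steep_sum0 ?subr0 //; nat_lia.
  case: eqP => [->|/eqP i1].
    rewrite dS steep_sum_high ?head_sum_full ?lerDl ?low //; try nat_lia.
    - lra.
    - exact: ltW.
  by rewrite !low ?head_sumS; [lra|nat_lia|nat_lia].
have [/andP[l0 ld] lt lmax] := cut_lengthP le_eps.
move: (cut_length mu eps) l0 ld lt lmax => l l0 ld lt lmax.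
have high k : (d - l <= k <= d)%N -> steep_sum k = 1.
  move=> kd; apply: steep_sum_high; first nat_lia.
  have : head_sum (d - l) <= head_sum k by apply: head_sum_le; nat_lia.
  by move: lt; rewrite tail_sumE; [lra|nat_lia].
case: eqP => [l1|/eqP l1].
  rewrite (nth_mktuple _ _ (Ordinal id)) /=.
  case: eqP => [->|/eqP i0].
    by rewrite [steep_sum 1%N]high ?steep_sum0 ?subr0 //; nat_lia.
  by rewrite !high ?subrr //; nat_lia.
rewrite (nth_mktuple _ _ (Ordinal id)) /=.
(* By maximality of [l], the tail with one more entry already exceeds [eps]. *)
have low k : (0 < k < d - l)%N -> steep_sum k = head_sum k + eps.
  move=> kd; apply: steep_sum_low; first nat_lia.
  have : eps < tail_sum mu l.+1 by apply: lmax; nat_lia.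
  rewrite tail_sumE; last nat_lia.
  have : head_sum k <= head_sum (d - l.+1) by apply: head_sum_le; nat_lia.
  lra.
case: eqP => [->|/eqP i0].
  by rewrite [steep_sum 1%N]low ?head_sum1 ?steep_sum0 ?subr0 //; nat_lia.
case: ltnP => i1.
  by rewrite !low ?head_sumS; [lra|nat_lia|nat_lia].
(* The passage from [low] to [high]: this entry gives up the part of [eps] that the tail does not
   cover. *)
case: eqP => [i2|/eqP i2].
  rewrite high ?low; [|nat_lia|nat_lia].
  have dl : (d - l = i.+1)%N by nat_lia.
  have -> : tail_sum mu l = 1 - (head_sum i + mu`_i).
    by rewrite tail_sumE ?dl ?head_sumS //; nat_lia.
  lra.
by rewrite !high ?subrr //; nat_lia.
Qed.

Lemma steepened_head k : (k <= d)%N ->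
  \sum_(i < k) (steepened_spectrum mu eps)`_i = steep_sum k.
Proof.
elim: k => [|k IH] kd; first by rewrite big_ord0.
by rewrite big_ord_recr /= IH ?(ltnW kd) // steepened_diff // addrC subrK.
Qed.

Lemma steepened_sum : \sum_(i < d) (steepened_spectrum mu eps)`_i = 1.
Proof.
rewrite steepened_head // steep_sum_high //; first exact: ltnW.
by rewrite head_sum_full lerDl ltW.
Qed.

(** Capping at 1 can only shorten the increment [mu_i]. The index starts at 1 because the very first
    increment also receives [eps], up to the cap. *)
Lemma steep_sumS i : (0 < i < d)%N ->
  steep_sum i <= steep_sum i.+1 <= steep_sum i + mu`_i.
Proof.
case: i => // i id; rewrite /steep_sum !(head_sumS i.+1).
have := mu_ge0 id; set T := head_sum _.
by case: (lerP 1 (T + eps)); case: (lerP 1 (T + mu`_i.+1 + eps)); lra.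
Qed.

Lemma steepened_ge0 i : (i < d)%N -> 0 <= (steepened_spectrum mu eps)`_i.
Proof.
case: i => [|i] id; rewrite steepened_diff // subr_ge0; last first.
  by have /andP[] := steep_sumS (i := i.+1) id.
rewrite steep_sum0 /steep_sum le_min ler01 head_sum1 addr_ge0 ?mu_ge0 //.
exact: ltW.
Qed.

(** The differences sum to zero, so the distance is twice their positive part; only the first entry
    can grow, by at most [eps]. *)
Lemma steepened_dist :
  \sum_(i < d) `|(steepened_spectrum mu eps)`_i - mu`_i| <= 2 * eps.
Proof.
have d0 : (0 < d)%N by nat_lia.
have s0 : \sum_(i < d) ((steepened_spectrum mu eps)`_i - mu`_i) = 0.
  by rewrite sumrB mu_sum steepened_sum subrr.
(* [|z| + z] vanishes for [z <= 0], which leaves the term of index 0. *)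
have <- : \sum_(i < d) (`|(steepened_spectrum mu eps)`_i - mu`_i|
    + ((steepened_spectrum mu eps)`_i - mu`_i)) =
    \sum_(i < d) `|(steepened_spectrum mu eps)`_i - mu`_i|.
  by rewrite big_split /= s0 addr0.
rewrite (bigD1 (Ordinal d0)) //= big1 ?addr0.
  rewrite steepened_diff //= steep_sum0 subr0 /steep_sum head_sum1.
  have e0 := eps_gt0; have := mu_le1 d0.
  by case: (lerP 1 (mu`_0 + eps)) => h m1; rewrite ger0_norm; lra.
move=> i; rewrite -val_eqE /= => i0.
have := @steep_sumS i; rewrite steepened_diff // ltn_ord andbT lt0n i0.
by move=> /(_ isT) /andP[h1 h2]; rewrite ler0_norm; lra.
Qed.

End Spectra.

(** * Extremal states of the ball *)

Section Extremal.
Local Open Scope sesquilinear_scope.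
Variables (R : realType) (d : nat) (mu : d.-tuple R) (eps : R).
Variables (sigma : 'M[R[i]]_d) (e : 'I_d -> 'cV[R[i]]_d).
Hypothesis d_ge2 : (2 <= d)%N.
Hypothesis sigma_density : density sigma.
Hypothesis sigma_eigen : eigendecomposition sigma mu e.
Hypothesis eps_gt0 : 0 < eps.
Implicit Types (V A B : 'M[R[i]]_d) (p q : d.-tuple R).

Let V := basis_mx e.

Let V_unitary : V \is unitarymx.
Proof. by case: sigma_eigen => eo _ _; apply: basis_mx_unitary. Qed.

Let sigmaE : sigma = unitary_diag V mu.
Proof. by case: sigma_eigen => _ _ ->; rewrite diagonal_opE. Qed.

Let mu_sorted : sorted >=%R mu.
Proof. by case: sigma_eigen. Qed.

Let mu_ge0 i : (i < d)%N -> 0 <= mu`_i.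
Proof.
have := sigma_density; rewrite sigmaE => /(density_spectrum V_unitary)[h _].
exact: h.
Qed.

Let mu_sum : \sum_(i < d) mu`_i = 1.
Proof.
by have := sigma_density; rewrite sigmaE => /(density_spectrum V_unitary)[_].
Qed.

Lemma excess_unitary_diag p t :
  excess (eigenvalues (unitary_diag V p)) t = excess p t.
Proof. by apply: perm_big; apply: perm_eigenvalues. Qed.

Lemma state_ball_unitary_diag p : (forall i, (i < d)%N -> 0 <= p`_i) ->
  \sum_(i < d) p`_i = 1 -> \sum_(i < d) `|p`_i - mu`_i| <= 2 * eps ->
  state_ball eps sigma (unitary_diag V p).
Proof.
move=> p0 p1 pmu; split; first exact: unitary_diag_density.
by rewrite sigmaE trace_norm_unitary_diagB // ler_pdivrMl.
Qed.

Lemma state_ball_excess omega t : state_ball eps sigma omega ->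
  excess (eigenvalues omega) t <= excess mu t + eps /\
  excess mu t <= excess (eigenvalues omega) t + eps.
Proof.
move=> [od oeps]; have oh := od.1.1; have sh := sigma_density.1.1.
have tr : \tr omega = \tr sigma by rewrite od.2 sigma_density.2.
have E : excess mu t = excess (eigenvalues sigma) t.
  by rewrite sigmaE excess_unitary_diag.
rewrite E; split.
  by apply: le_trans (excess_trace_norm _ oh sh tr) _; rewrite lerD2l.
apply: le_trans (excess_trace_norm _ sh oh (esym tr)) _.
by rewrite lerD2l trace_normBC.
Qed.

Lemma rho_upperE : rho_upper mu eps sigma e =
  if \sum_(i < d) `|mu`_i - d%:R^-1| <= 2 * eps
  then unitary_diag V [tuple d%:R^-1 | _ < d]
  else unitary_diag V (flattened_spectrum mu eps).
Proof.
rewrite /rho_upper diagonal_opE (max_mixed_unitary_diag V_unitary).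
rewrite sigmaE trace_norm_unitary_diagB // ler_pdivrMl //.
by under eq_bigr do rewrite nth_mktuple.
Qed.

Lemma not_near : (\sum_(i < d) `|mu`_i - d%:R^-1| <= 2 * eps) = false ->
  eps < 2^-1 * \sum_(i < d) `|mu`_i - d%:R^-1|.
Proof. by rewrite ltr_pdivlMl // ltNge => ->. Qed.

Lemma sum_const_inv : \sum_(i < d) [tuple d%:R^-1 : R | _ < d]`_i = 1.
Proof.
under eq_bigr do rewrite nth_mktuple.
rewrite sumr_const card_ord -(mulr_natr d%:R^-1) mulVf // pnatr_eq0.
by rewrite -lt0n ltnW.
Qed.

Lemma rho_upper_ball : state_ball eps sigma (rho_upper mu eps sigma e).
Proof.
rewrite rho_upperE; case: ifP => [near|/not_near far].
  apply: state_ball_unitary_diag; last 1 first.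
  - by under eq_bigr do rewrite nth_mktuple distrC.
  - by move=> i id; rewrite (nth_mktuple _ _ (Ordinal id)) invr_ge0.
  - exact: sum_const_inv.
apply: state_ball_unitary_diag.
- exact: flattened_ge0.
- exact: flattened_sum.
- by rewrite flattened_dist.
Qed.

Lemma rho_upper_majorized omega : state_ball eps sigma omega ->
  state_majorized (rho_upper mu eps sigma e) omega.
Proof.
move=> ob; have [o0 o1] := density_eigenvalues ob.1.
apply: excess_majorized => [|t].
  by rewrite o1; case: (density_eigenvalues rho_upper_ball.1).
rewrite rho_upperE; case: ifP => [_|/not_near far]; rewrite excess_unitary_diag.
  (* The uniform spectrum has excess [1 - d t] up to [1/d] and 0 beyond, the least possible for a
     spectrum of sum 1. *)
  have [td|dt] := leP t d%:R^-1; last first.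
    rewrite {1}excess_ord big1 ?excess_ge0 // => i _; apply/max_idPr.
    by rewrite nth_mktuple subr_le0 ltW.
  apply: (@le_trans _ _ (\sum_(i < d) ((eigenvalues omega)`_i - t))).
    rewrite sumrB o1 -[X in X - _]sum_const_inv -sumrB excess_ord.
    by apply: ler_sum => i _; rewrite ge_max lexx nth_mktuple subr_ge0.
  by rewrite excess_ord; apply: ler_sum => i _; rewrite le_max lexx.
by apply: flattened_excess_le => //; case: (state_ball_excess t ob).
Qed.

Lemma rho_lower_ball : state_ball eps sigma (rho_lower mu eps e).
Proof.
rewrite /rho_lower diagonal_opE; apply: state_ball_unitary_diag.
- exact: steepened_ge0.
- exact: steepened_sum.
- exact: steepened_dist.
Qed.

(** Partial sums are compared directly, with [steep_sum mu eps k] in between. *)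
Lemma rho_lower_majorized omega : state_ball eps sigma omega ->
  state_majorized omega (rho_lower mu eps e).
Proof.
move=> ob; have [o0 o1] := density_eigenvalues ob.1.
split=> [k /andP[k0 kd]|]; last first.
  by rewrite o1; case: (density_eigenvalues rho_lower_ball.1).
have kd' : (k <= d)%N by apply: leq_trans kd (leq_pred d).
apply: (@le_trans _ _ (steep_sum mu eps k)); last first.
  (* The sum of the [k] largest entries is at least the sum of the first [k]. *)
  rewrite -(steepened_head d_ge2 mu_ge0 mu_sum eps_gt0 kd').
  rewrite /rho_lower diagonal_opE; set x := eigenvalues _.
  rewrite [leRHS]excess_sorted ?sort_ge_sorted ?size_sort ?size_tuple ?k0 //.
  rewrite excess_sort excess_unitary_diag; apply: sum_le_excess.
  by rewrite size_tuple.
have bound t : \sum_(j < k) (sort >=%R (eigenvalues omega))`_j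
    <= k%:R * t + excess (eigenvalues omega) t.
  rewrite -(excess_sort (eigenvalues omega)); apply: sum_le_excess.
  by rewrite size_sort size_tuple.
case: k k0 kd kd' bound => // k _ kd kd' bound.
(* The level 0 gives the bound 1. The level [mu_k], at which [excess_sorted] is an equality for
   [mu], gives the bound with [eps]. *)
rewrite /steep_sum le_min; apply/andP; split.
  apply: le_trans (bound 0) _; rewrite mulr0 add0r excess_ord -o1.
  by apply: ler_sum => i _; rewrite subr0 ge_max lexx o0.
apply: le_trans (bound mu`_k) _.
have [h _] := state_ball_excess mu`_k ob.
rewrite /head_sum big_mkord excess_sorted ?size_tuple //= -addrA lerD2l.
exact: h.
Qed.

(** Convexity of the ball, through [trace_norm_lin]; the weight [1 - 2^-1] keeps the shape of
    [strictly_concave] at [t = 2^-1]. *)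
Lemma state_ball_midpoint rho omega : state_ball eps sigma rho ->
  state_ball eps sigma omega ->
  state_ball eps sigma ((2^-1)%:C *: rho + (1 - 2^-1)%:C *: omega).
Proof.
have half_half : 2^-1 + 2^-1 = 1 :> R by lra.
have half2 : (2^-1 : R)%:C + (2^-1 : R)%:C = 1 by rewrite -rmorphD half_half.
have h : 1 - 2^-1 = 2^-1 :> R by lra.
have h0 : 0 <= 2^-1 :> R by rewrite invr_ge0.
have hC : 0 <= (2^-1 : R)%:C by rewrite ler0c.
move=> [rd re] [od oe].
have rh := rd.1.1; have oh := od.1.1; have sh := sigma_density.1.1.
rewrite h; split.
  split; last by rewrite linearD !linearZ /= rd.2 od.2 mulr1.
  split; first exact: hermsymmx_lin.
  move=> v; rewrite mulmxDr mulmxDl -!scalemxAr -!scalemxAl mxE.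
  rewrite [X in X + _]mxE [X in _ + X]mxE.
  by apply: addr_ge0; apply: mulr_ge0 => //; [exact: rd.1.2|exact: od.1.2].
have -> : (2^-1)%:C *: rho + (2^-1)%:C *: omega - sigma =
    (2^-1)%:C *: (rho - sigma) + (2^-1)%:C *: (omega - sigma).
  by rewrite !scalerBr addrACA -opprD -scalerDl half2 scale1r.
apply: le_trans (ler_wpM2l h0 (trace_norm_lin _ _ h0 h0)) _.
- exact: hermsymmxB.
- exact: hermsymmxB.
rewrite mulrDr; apply: le_trans (lerD (ler_wpM2l h0 re) (ler_wpM2l h0 oe)) _.
by rewrite -mulrDl half_half mul1r.
Qed.

End Extremal.

(** * Optimality and uniqueness of the two extremal states *)

Lemma unitarily_equivalent_sym (R : realType) d (rho omega : 'M[R[i]]_d) :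
  unitarily_equivalent rho omega -> unitarily_equivalent omega rho.
Proof.
case=> U Uu ->; exists (U^t*)%sesqui; first by rewrite trmxC_unitary.
rewrite trmxCK -(invmx_unitary Uu) !mulmxA mulVmx ?unitarymx_unit //.
by rewrite mul1mx mulmxKV ?unitarymx_unit.
Qed.

Theorem corollary3p2 (R : realType) (d : nat) (hd : (2 <= d)%N)
    (sigma : 'M[R[i]]_d) (hsigma : density sigma)
    (mu : d.-tuple R) (e : 'I_d -> 'cV[R[i]]_d)
    (hmu : eigendecomposition sigma mu e)
    (eps : R) (heps : 0 < eps <= 1)
    (phi : 'M[R[i]]_d -> R) (hphi : Schur_concave phi) :
  [/\ argmax (state_ball eps sigma) phi (rho_upper mu eps sigma e),
      argmin (state_ball eps sigma) phi (rho_lower mu eps e),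
      strictly_Schur_concave phi ->
        (forall rho', argmax (state_ball eps sigma) phi rho' ->
           unitarily_equivalent rho' (rho_upper mu eps sigma e)) /\
        (forall rho', argmin (state_ball eps sigma) phi rho' ->
           unitarily_equivalent rho' (rho_lower mu eps e))
    & strictly_concave phi ->
        argmax (state_ball eps sigma) phi = [set rho_upper mu eps sigma e]].
Proof.
have /andP[eps_gt0 _] := heps.
have ub := rho_upper_ball hd hsigma hmu eps_gt0.
have lb := rho_lower_ball hd hsigma hmu eps_gt0.
have um := rho_upper_majorized hd hsigma hmu eps_gt0.
have lm := rho_lower_majorized hd hsigma hmu eps_gt0.
have umax : argmax (state_ball eps sigma) phi (rho_upper mu eps sigma e).
  by split=> // y yb; apply: hphi (um y yb); [exact: ub.1|exact: yb.1].
have lmin : argmin (state_ball eps sigma) phi (rho_lower mu eps e).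
  by split=> // y yb; apply: hphi (lm y yb); [exact: yb.1|exact: lb.1].
split=> // [[_ strict]|strict].
  split=> rho [rb rmax]; apply: boolp.contrapT => nue.
    (* Here [rho_upper] is the majorized state and comes first, so the equivalence has to be
       reversed. *)
    have nue' := nue \o @unitarily_equivalent_sym _ _ _ _.
    have := strict _ _ ub.1 rb.1 (um _ rb) nue'.
    by rewrite ltNge rmax.
  by have := strict _ _ rb.1 lb.1 (lm _ rb) nue; rewrite ltNge rmax.
apply/seteqP; split=> [rho [rb rmax]|_ ->//] /=.
apply/eqP; apply: boolp.contrapT => /negP ne.
have half : (0 < 2^-1 :> R) && (2^-1 < 1 :> R).
  by rewrite invr_gt0 ltr0n invf_lt1 ?ltr0n // ltr1n.
(* Strict concavity puts the value at the midpoint above the common maximum of the two states,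
   although the midpoint lies in the ball. *)
have := strict rho _ _ rb.1 ub.1 ne half.
have := rmax _ (state_ball_midpoint hsigma rb ub); have := rmax _ ub.
move: (umax.2 _ rb); move: (phi _) (phi _) (phi _) => a b c; clear; lra.
Qed.
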